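(* Suppose that $\cos(\alpha)$ is transcendental and that $n$ is a positive integer that is not a power of $2$. Then $\alpha$ is not $n$-sectable. Therefore, for every positive integer $n$ that is not a power of $2$, the set of all non-$n$-sectable angles is uncountable, and the set of all $n$-sectable angles is countable (as sets of points $(\cos\alpha,\sin\alpha)$ of the unit circle).
   Context: Let $S\subseteq\mathbb{R}^2$ contain $(0,0)$ and $(1,0)$. A point is constructible over $S$ if it can be obtained from points of $S$ by a finite sequence of straightedge-and-compass steps: (1) given two distinct points already available, one may draw the line through them, or the circle centered at one of them and passing through the other; (2) given two lines, two circles, or a line and a circle already drawn, one may add their intersection points. $C(S)$ denotes the set of all points constructible over $S$. An angle is given by its radian measure $\alpha\in\mathbb{R}$ and is represented by the point $(\cos\alpha,\sin\alpha)$ of the unit circle. The angle $\alpha$ is $n$-sectable if $(\cos(\alpha/n),\sin(\alpha/n))\in C(\{(0,0),(1,0),(\cos\alpha,\sin\alpha)\})$, and non-$n$-sectable otherwise. Powers of $2$ include $2^0=1$. *)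

(* Defs.v *)
From mathcomp Require Import all_boot all_order all_algebra.
From mathcomp Require Import all_classical all_reals all_analysis.

Set Implicit Arguments.
Unset Strict Implicit.
Unset Printing Implicit Defensive.

Import GRing.Theory Num.Theory.

Local Open Scope classical_set_scope.
Local Open Scope ring_scope.

Definition transcendental (R : realType) (x : R) : Prop :=
  ~ algebraicOver (ratr : rat -> R) x.

(* For p = q the equation below is satisfied by the whole plane; [line p q] is
   only used for p <> q. *)
Definition line (R : realType) (p q : R * R) : set (R * R) :=
  [set z | (z.1 - p.1) * (q.2 - p.2) = (z.2 - p.2) * (q.1 - p.1)].

(* The library norm on R * R is the sup norm, hence the explicit Euclidean
   distance. *)
Definition edist (R : realType) (p q : R * R) : R :=
  Num.sqrt ((p.1 - q.1) ^+ 2 + (p.2 - q.2) ^+ 2).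

Definition circle (R : realType) (c q : R * R) : set (R * R) :=
  [set z | edist c z = edist c q].

(* Lines and circles are compared as point sets: without the requirement that
   the two curves differ, every point of a drawn line would be an intersection
   point of that line with itself. *)
Inductive constructible (R : realType) (S : set (R * R)) : R * R -> Prop :=
| constructible_given p :
    S p -> constructible S p
| constructible_line_line l1 l2 p :
    drawn_line S l1 -> drawn_line S l2 -> l1 <> l2 ->
    l1 p -> l2 p -> constructible S p
| constructible_line_circle l c p :
    drawn_line S l -> drawn_circle S c ->
    l p -> c p -> constructible S p
| constructible_circle_circle c1 c2 p :
    drawn_circle S c1 -> drawn_circle S c2 -> c1 <> c2 ->
    c1 p -> c2 p -> constructible S p
with drawn_line (R : realType) (S : set (R * R)) : set (R * R) -> Prop :=
| draw_line p q :
    constructible S p -> constructible S q -> p <> q ->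
    drawn_line S (line p q)
with drawn_circle (R : realType) (S : set (R * R)) : set (R * R) -> Prop :=
| draw_circle p q :
    constructible S p -> constructible S q -> p <> q ->
    drawn_circle S (circle p q).

Definition angle_point (R : realType) (alpha : R) : R * R :=
  (cos alpha, sin alpha).

Definition sectable (R : realType) (n : nat) (alpha : R) : Prop :=
  constructible [set (0, 0); (1, 0); angle_point alpha]
    (angle_point (alpha / n%:R)).

Definition power_of_two (n : nat) : Prop := exists k, n = (2 ^ k)%N.

(* Main.v *)
Require Import Defs.
From HB Require Import structures.
From mathcomp Require Import all_boot all_order all_algebra.
From mathcomp Require Import all_classical all_reals all_analysis.
From mathcomp Require Import complex ring lra.

(** Write n = 2^k * m with m > 1 odd and z = e^(i alpha), which is transcendental
    because (z + 1/z)/2 = cos alpha is. By degrees, z is not an m-th power in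
    Q(z). A quadratic extension K(w) of a field K containing z has no m-th root
    of z unless K has one (m is odd, take norms), so a subfield of C that
    contains z and is maximal (Zorn) among those without m-th root of z is closed
    under square roots. It then contains the coordinates of every point
    constructible over (0,0), (1,0) and (cos alpha, sin alpha). If alpha were
    n-sectable, e^(i alpha / n)^(2^k) would be an m-th root of z in it.
    Hence sectable angles have algebraic cosine, and give countably many points
    of the uncountable circle. *)

Set Implicit Arguments.
Unset Strict Implicit.
Unset Printing Implicit Defensive.

Import Order.TTheory GRing.Theory Num.Theory.

Local Open Scope classical_set_scope.
Local Open Scope ring_scope.

Ltac subfield := repeat first
  [ assumption | apply: rpred0 | apply: rpred1 | apply: rpred_nat
  | apply: rpredD | rewrite rpredN | rewrite rpredV | apply: rpredM
  | apply: rpredX ].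

(** * Quadratic extensions and closure under square roots *)

Definition adjoin (F : fieldType) (K : {pred F}) (w : F) : set F :=
  [set x | exists a b, [/\ a \in K, b \in K & x = a + b * w]].

(** Inverses come from the conjugate: [(a + b * w) * (a - b * w)] is the norm [a^2 - b^2 w^2], an
    element of [K]. For [b != 0] it is nonzero, as otherwise [w] would be [a / b] or [- a / b],
    hence in [K]. *)
Lemma adjoin_divring_closed (F : fieldType) (K : divringClosed F) (w : F) :
  w ^+ 2 \in K -> w \notin K -> GRing.divring_closed (mem (adjoin K w)).
Proof.
move=> w2K wK; have w2E (a b c d : F) : (a + b * w) * (c + d * w) =
    (a * c + b * d * w ^+ 2) + (a * d + b * c) * w by ring.
have adjM x y : adjoin K w x -> adjoin K w y -> adjoin K w (x * y).
  move=> [a [b [aK bK ->]]] [c [d [cK dK ->]]].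
  exists (a * c + b * d * w ^+ 2), (a * d + b * c).
  by rewrite w2E; split=> //; subfield.
split.
- by rewrite inE; exists 1, 0; rewrite rpred1 rpred0 mul0r addr0.
- move=> x y; rewrite !inE => -[a [b [aK bK ->]]] [c [d [cK dK ->]]].
  by exists (a - c), (b - d); split; [subfield|subfield|ring].
- move=> x y; rewrite !inE => xK yK; apply: adjM => //.
  case: yK => a [b [aK bK ->]].
  (* The case [b = 0] includes the divisor [0], whose inverse is [0] by convention. *)
  have [->|b0] := eqVneq b 0.
    by exists a^-1, 0; split; [subfield|subfield|rewrite !mul0r !addr0].
  set N := a ^+ 2 - b ^+ 2 * w ^+ 2.
  have NK : N \in K by subfield.
  have NE : N = (a + b * w) * (a - b * w) by rewrite /N; ring.
  have N0 : N != 0.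
    rewrite NE mulf_eq0 negb_or; apply/andP; split; apply: contra wK.
      rewrite addrC addr_eq0 => /eqP bw.
      by rewrite -[w](mulKf b0) bw rpredM ?rpredV ?rpredN.
    rewrite subr_eq0 => /eqP bw.
    by rewrite -[w](mulKf b0) -bw rpredM ?rpredV.
  have w0 : a + b * w != 0 by apply: contraNneq N0; rewrite NE => ->; rewrite mul0r.
  exists (a / N), (- b / N); split; [by subfield|by subfield|].
  apply: (mulfI w0); rewrite mulfV// -[LHS](mulfV N0) {1}NE; ring.
Qed.

Lemma sub_adjoin (F : fieldType) (K : divringClosed F) (w : F) :
  [set` K] `<=` adjoin K w.
Proof. by move=> x xK; exists x, 0; split; rewrite ?rpred0 ?mul0r ?addr0. Qed.

Lemma mem_adjoin (F : fieldType) (K : divringClosed F) (w : F) : adjoin K w w.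
Proof. by exists 0, 1; rewrite rpred0 rpred1 mul1r add0r. Qed.

(* Conjugating [w |-> - w] and multiplying, the norm [N = a^2 - b^2 w^2] of a
   root satisfies [N^p = z^2]; as [p] is odd, [z = (N^((p+1)/2) / z)^p]. *)
Lemma adjoin_no_root (F : fieldType) (K : divringClosed F) (p : nat) (z w : F) :
  odd p -> z \in K -> (forall x, x \in K -> x ^+ p != z) ->
  w ^+ 2 \in K -> w \notin K -> forall x, adjoin K w x -> x ^+ p != z.
Proof.
move=> p_odd zK noroot w2K wK _ [a [b [aK bK ->]]].
(* If [z = 0], then [0] is already a [p]-th root in [K], since an odd [p] is positive. *)
have [|z0] := eqVneq z 0.
  move=> z0; have := noroot 0 (rpred0 _).
  by rewrite z0 expr0n; case: (p) p_odd => //=; rewrite eqxx.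
have [A [B [AK BK AE BE]]] : exists A B, [/\ A \in K, B \in K,
    (a + b * w) ^+ p = A + B * w & (a - b * w) ^+ p = A - B * w].
  elim: (p) => [|m [A [B [AK BK AE BE]]]].
    by exists 1, 0; rewrite rpred1 rpred0 !expr0 !mul0r subr0 addr0.
  exists (a * A + b * B * w ^+ 2), (a * B + b * A).
  rewrite ![_ ^+ m.+1]exprS AE BE; split; [by subfield|by subfield|ring|ring].
(* A nonzero [B] would give [w = (z - A) / B] in [K]. With [B = 0] the conjugate [a - b * w] is a
   [p]-th root of [z] too. *)
apply/eqP => rootz; have B0 : B = 0.
  apply/eqP; apply: contraNT wK => B0.
  have -> : w = (z - A) / B by rewrite -rootz AE addrAC subrr add0r mulrC mulKf.
  by rewrite rpredM ?rpredB ?rpredV.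
move: AE BE; rewrite B0 mul0r subr0 addr0 rootz => <- BE.
pose N := a ^+ 2 - b ^+ 2 * w ^+ 2.
have NK : N \in K by subfield.
have NE : N ^+ p = z ^+ 2.
  by rewrite expr2 -{1}rootz -{1}BE -exprMn; congr (_ ^+ p); rewrite /N; ring.
have rK : N ^+ (p.+1)./2 / z \in K by subfield.
apply/negP: (noroot _ rK); rewrite negbK.
rewrite expr_div_n -exprM mulnC exprM NE -exprM mul2n.
rewrite halfK /= p_odd subn0 exprS mulfK ?expf_neq0//.
Qed.

(** Take a maximal subfield containing [z] but no [p]-th root of [z]. If it lacked some [x] whose
    square it contains, adjoining [x] would give a strictly larger such subfield. *)
Lemma sqrt_closed_extension (F : fieldType) (K0 : divringClosed F) (p : nat)
    (z : F) :
  odd p -> z \in K0 -> (forall x, x \in K0 -> x ^+ p != z) ->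
  exists K : divringClosed F,
    [/\ z \in K, forall x, x \in K -> x ^+ p != z &
        forall x, x ^+ 2 \in K -> x \in K].
Proof.
move=> p_odd zK0 noroot0.
pose good (A : set F) :=
  [/\ GRing.divring_closed (mem A), A z & forall x, A x -> x ^+ p != z].
have [|A [Agood Amax]] := @Zorn_bigcup F [set A | A = set0 \/ good A].
  move=> C Cgood Ctot.
  have [[A [CA gA]]|nogood] := pselect (exists A, C A /\ good A); last first.
    left; rewrite -subset0 => x [A CA Ax]; case: nogood; exists A; split=> //.
    by case: (Cgood A CA) => // A0; rewrite A0 in Ax.
  right.
  have goodC B x : C B -> B x -> good B.
    by move=> CB Bx; case: (Cgood B CB) => // B0; rewrite B0 in Bx.
  (* Two elements of the union lie in a common member of the chain, so the closure properties pass
     to the union. *)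
  have common x y : (\bigcup_(X in C) X) x -> (\bigcup_(X in C) X) y ->
      exists B, [/\ C B, good B, B x & B y].
    move=> [B CB Bx] [D CD Dy]; have [BD|DB] := Ctot B D CB CD.
      by exists D; split=> //; [exact: goodC Dy|exact: BD].
    by exists B; split=> //; [exact: goodC Bx|exact: DB].
  split.
  - split.
    + by rewrite inE; exists A => //; case: gA => -[/set_mem].
    + move=> x y; rewrite !inE => xC yC.
      have [B [CB [[_ sB _] _ _] Bx By]] := common x y xC yC.
      by exists B => //; apply/set_mem/sB; apply/mem_set.
    + move=> x y; rewrite !inE => xC yC.
      have [B [CB [[_ _ dB] _ _] Bx By]] := common x y xC yC.
      by exists B => //; apply/set_mem/dB; apply/mem_set.
  - by exists A => //; case: gA.
  - by move=> x [B CB Bx]; have [_ _] := goodC B x CB Bx; exact.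
have good0 : good [set` K0].
  split=> //; split.
  - by rewrite inE /=; exact: rpred1.
  - by move=> x y; rewrite !inE /=; exact: rpredB.
  - by move=> x y; rewrite !inE /=; exact: rpred_div.
case: Agood => [A0|[Aclosed Az Anoroot]].
  have : A `<` [set` K0].
    by rewrite A0; split=> // /(_ z zK0).
  by move=> /Amax[]; right.
pose P : {pred F} := mem A.
pose HA := GRing.isDivringClosed.Build F P Aclosed.
pose K : divringClosed F := HB.pack P HA.
have KE x : x \in K = (x \in A) by [].
exists K; split=> [|x|x]; first by rewrite KE inE.
  by rewrite KE inE; exact: Anoroot.
move=> x2K; apply/negPn/negP => xK.
have := Amax (adjoin K x); apply.
  split=> [y Ay|adjA]; first by apply: sub_adjoin; rewrite /= KE inE.
  by move/negP: xK; apply; rewrite KE inE; apply: adjA; exact: mem_adjoin.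
right; split.
- exact: adjoin_divring_closed.
- by apply: sub_adjoin; rewrite /= KE inE.
- apply: adjoin_no_root => //; first by rewrite KE inE.
  by move=> y; rewrite KE inE; exact: Anoroot.
Qed.

(** * Rational functions in a transcendental element *)

(** [K] consists of the fractions [ev a / ev b], the field generated by [z] over the image of [f]. A
    [p]-th root of [z] would give [a^p = X b^p] as polynomials, by transcendence; the degrees are
    then [0] and [1] modulo [p], which is impossible for [p > 1]. *)
Lemma simple_transcendental_extension (F E : fieldType)
    (f : {rmorphism F -> E}) (z : E) (p : nat) :
  (1 < p)%N -> ~ algebraicOver f z ->
  exists K : divringClosed E,
    z \in K /\ forall x, x \in K -> x ^+ p != z.
Proof.
move=> p_gt1 ztr; pose ev (a : {poly F}) := (map_poly f a).[z].
have ev0 a : a != 0 -> ev a != 0.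
  by move=> a0; apply/negP => za; apply: ztr; exists a.
have evB a b : ev (a - b) = ev a - ev b by rewrite /ev rmorphB /= !hornerE.
have evM a b : ev (a * b) = ev a * ev b by rewrite /ev rmorphM /= !hornerE.
have ev1 : ev 1 = 1 by rewrite /ev rmorph1 hornerC.
have evz : ev 'X = z by rewrite /ev map_polyX hornerX.
have evX a m : ev (a ^+ m) = ev a ^+ m by rewrite /ev rmorphXn /= horner_exp.
pose A : set E := [set x | exists a b, b != 0 /\ x = ev a / ev b].
have Aclosed : GRing.divring_closed (mem A).
  split.
  - by rewrite inE; exists 1, 1; rewrite oner_eq0 ev1 divr1.
  - move=> x y; rewrite !inE => -[a [b [b0 ->]]] [c [d [d0 ->]]].
    exists (a * d - c * b), (b * d); rewrite mulf_neq0// evB !evM; split=> //.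
    by field; rewrite !ev0.
  - move=> x y; rewrite !inE => -[a [b [b0 ->]]] [c [d [d0 ->]]].
    have [->|c0] := eqVneq c 0.
      exists 0, 1; rewrite oner_eq0; split=> //.
      by rewrite -[0]/(0 : {poly F}) /ev rmorph0 !horner0 !mul0r invr0 mulr0.
    exists (a * d), (b * c); rewrite mulf_neq0// !evM; split=> //.
    by field; rewrite !ev0.
pose P : {pred E} := mem A.
pose HA := GRing.isDivringClosed.Build E P Aclosed.
pose K : divringClosed E := HB.pack P HA.
have KE x : x \in K = (x \in A) by [].
exists K; split; first by rewrite KE inE; exists 'X, 1; rewrite oner_eq0 ev1 divr1.
move=> x; rewrite KE inE => -[a [b [b0 ->]]]; apply/eqP => rootz.
have eqz : ev (a ^+ p - 'X * b ^+ p) = 0.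
  by rewrite evB evM !evX evz -rootz expr_div_n divfK ?subrr ?expf_neq0 ?ev0.
have {eqz rootz} /eqP : a ^+ p - 'X * b ^+ p = 0.
  by apply/eqP/negPn/negP => /ev0; rewrite eqz eqxx.
rewrite subr_eq0 => /eqP /(congr1 (fun q : {poly F} => (size q).-1)).
have bp0 : b ^+ p != 0 by rewrite expf_neq0.
rewrite mulrC size_mulX// size_exp.
have -> : (size (b ^+ p)).+1.-1 = ((size b).-1 * p).+1.
  by rewrite -size_exp /= prednK// size_poly_gt0.
move=> /(congr1 (modn^~ p)); rewrite modnMl -addn1 modnMDl modn_small//.
Qed.

(** * Intersections of lines and circles over a field closed under square roots *)

(** Completing the square: [(2 A x + B)^2] is the discriminant [B^2 - 4 A C]. *)
Lemma quadratic_mem (R : realFieldType) (K : divringClosed R)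
    (A B C x : R) :
  (forall y, y ^+ 2 \in K -> y \in K) ->
  A \in K -> B \in K -> C \in K -> A != 0 ->
  A * x ^+ 2 + B * x + C = 0 -> x \in K.
Proof.
move=> sqrtK AK BK CK A0 eqx.
have : (2 * A * x + B) ^+ 2 \in K.
  suff -> : (2 * A * x + B) ^+ 2 = B ^+ 2 - 4%:R * A * C by subfield.
  apply/eqP; rewrite -subr_eq0; apply/eqP.
  transitivity (4 * A * (A * x ^+ 2 + B * x + C)); first by ring.
  by rewrite eqx mulr0.
move=> /sqrtK yK; have -> : x = ((2 * A * x + B) - B) / (2%:R * A).
  by field.
by subfield.
Qed.

(** Substituting [y = (c - a x) / b] and multiplying by [b^2] leaves a quadratic equation for [x].
    Its leading coefficient [a^2 + b^2] is nonzero because the field is ordered. *)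
Lemma line_conic_mem (R : realFieldType) (K : divringClosed R)
    (a b c d e f x y : R) :
  (forall t, t ^+ 2 \in K -> t \in K) ->
  a \in K -> b \in K -> c \in K -> d \in K -> e \in K -> f \in K -> b != 0 ->
  a * x + b * y = c -> x ^+ 2 + y ^+ 2 + d * x + e * y + f = 0 ->
  x \in K /\ y \in K.
Proof.
move=> sqrtK aK bK cK dK eK fK b0 onl onc.
have yE : y = (c - a * x) / b by rewrite -onl; field.
suff xK : x \in K by rewrite yE; split=> //; subfield.
apply: (@quadratic_mem _ K (a ^+ 2 + b ^+ 2)
  (d * b ^+ 2 - 2%:R * a * c - e * a * b) (c ^+ 2 + e * b * c + f * b ^+ 2)) => //.
1-3: by subfield.
- by rewrite paddr_eq0 ?sqr_ge0// negb_and !sqrf_eq0 b0 orbT.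
- rewrite -[RHS](mulr0 (b ^+ 2)) -onc yE; field => //.
Qed.

Lemma line_circle_mem (R : realFieldType) (K : divringClosed R)
    (a b c d e f x y : R) :
  (forall t, t ^+ 2 \in K -> t \in K) ->
  a \in K -> b \in K -> c \in K -> d \in K -> e \in K -> f \in K ->
  (a != 0) || (b != 0) ->
  a * x + b * y = c -> x ^+ 2 + y ^+ 2 + d * x + e * y + f = 0 ->
  x \in K /\ y \in K.
Proof.
move=> sqrtK aK bK cK dK eK fK /orP[a0|b0] onl onc; last first.
  exact: (line_conic_mem sqrtK aK bK cK dK eK fK).
have [] := @line_conic_mem _ K b a c e d f y x sqrtK bK aK cK eK dK fK a0 => //.
  by rewrite addrC.
by rewrite -onc; ring.
Qed.

Lemma pair_neq_sub (R : realFieldType) (p q : R * R) :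
  p <> q -> (q.2 - p.2 != 0) || (p.1 - q.1 != 0).
Proof.
case: p q => [p1 p2] [q1 q2] /= pq; rewrite -negb_and; apply/negP => /andP[].
by rewrite !subr_eq0 => /eqP e2 /eqP e1; apply: pq; rewrite e1 e2.
Qed.

Lemma lineE (R : realType) (p q z : R * R) :
  line p q z <-> (q.2 - p.2) * z.1 + (p.1 - q.1) * z.2 =
                 (q.2 - p.2) * p.1 + (p.1 - q.1) * p.2.
Proof. by rewrite /line /=; split=> h; lra. Qed.

Lemma line_through (R : realType) (p q z t : R * R) :
  line p q z ->
  line p q t <-> (q.2 - p.2) * (t.1 - z.1) + (p.1 - q.1) * (t.2 - z.2) = 0.
Proof.
by move=> /lineE zl; split=> [/lineE|] h; [|apply/lineE]; lra.
Qed.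

Lemma circleE (R : realType) (c q z : R * R) :
  circle c q z <-> (c.1 - z.1) ^+ 2 + (c.2 - z.2) ^+ 2 =
                   (c.1 - q.1) ^+ 2 + (c.2 - q.2) ^+ 2.
Proof.
rewrite /circle /Defs.edist /=; split=> [/eqP|h]; last by rewrite h.
by rewrite eqr_sqrt ?addr_ge0 ?sqr_ge0// => /eqP.
Qed.

(** A zero determinant makes the two normals proportional, so a direction of the first line is also
    one of the second. *)
Lemma parallel_lines (R : fieldType) (a b a' b' u v : R) :
  (a != 0) || (b != 0) -> a * b' - a' * b = 0 ->
  a * u + b * v = 0 -> a' * u + b' * v = 0.
Proof.
move=> ab0 D uv; apply/eqP; case/orP: ab0 => [a0|b0].
  have /eqP : a * (a' * u + b' * v) = 0.
    transitivity (a' * (a * u + b * v) + v * (a * b' - a' * b)); first by ring.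
    by rewrite uv D !mulr0 addr0.
  by rewrite mulf_eq0 (negPf a0).
have /eqP : b * (a' * u + b' * v) = 0.
  transitivity (b' * (a * u + b * v) - u * (a * b' - a' * b)); first by ring.
  by rewrite uv D !mulr0 subr0.
by rewrite mulf_eq0 (negPf b0).
Qed.

Lemma line_line_mem (R : realType) (K : divringClosed R) (p q p' q' z : R * R) :
  p.1 \in K -> p.2 \in K -> q.1 \in K -> q.2 \in K ->
  p'.1 \in K -> p'.2 \in K -> q'.1 \in K -> q'.2 \in K ->
  p <> q -> p' <> q' -> line p q <> line p' q' ->
  line p q z -> line p' q' z -> z.1 \in K /\ z.2 \in K.
Proof.
move=> p1 p2 q1 q2 p1' p2' q1' q2' /pair_neq_sub pq /pair_neq_sub pq' neq zl zl'.
move: (zl) (zl') => /lineE zE /lineE zE'.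
(* Parallel lines with the common point [z] coincide as point sets, which is excluded. *)
have [D0|D0] := eqVneq
    ((q.2 - p.2) * (p'.1 - q'.1) - (q'.2 - p'.2) * (p.1 - q.1)) 0.
  exfalso; apply: neq; apply/seteqP; split=> t.
    move=> /(line_through _ zl) /(parallel_lines pq D0) h.
    exact/(line_through _ zl').
  have D0' : (q'.2 - p'.2) * (p.1 - q.1) - (q.2 - p.2) * (p'.1 - q'.1) = 0.
    by rewrite -opprB D0 oppr0.
  move=> /(line_through _ zl') /(parallel_lines pq' D0') h.
  exact/(line_through _ zl).
set a := q.2 - p.2 in D0 zE; set b := p.1 - q.1 in D0 zE.
set a' := q'.2 - p'.2 in D0 zE'; set b' := p'.1 - q'.1 in D0 zE'.
pose d := a * p.1 + b * p.2; pose d' := a' * p'.1 + b' * p'.2.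
(* Cramer's rule for the two line equations. *)
have z1 : z.1 = (d * b' - d' * b) / (a * b' - a' * b).
  by rewrite /d /d' -zE -zE'; field.
have z2 : z.2 = (a * d' - a' * d) / (a * b' - a' * b).
  by rewrite /d /d' -zE -zE'; field.
by rewrite z1 z2 /d /d' /a /b /a' /b'; split; subfield.
Qed.

Lemma line_circle_points_mem (R : realType) (K : divringClosed R)
    (p q c r z : R * R) :
  (forall t, t ^+ 2 \in K -> t \in K) ->
  p.1 \in K -> p.2 \in K -> q.1 \in K -> q.2 \in K ->
  c.1 \in K -> c.2 \in K -> r.1 \in K -> r.2 \in K ->
  p <> q -> line p q z -> circle c r z -> z.1 \in K /\ z.2 \in K.
Proof.
move=> sqrtK p1 p2 q1 q2 c1 c2 r1 r2 /pair_neq_sub pq /lineE zl /circleE zc.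
apply: (@line_circle_mem _ K (q.2 - p.2) (p.1 - q.1)
  ((q.2 - p.2) * p.1 + (p.1 - q.1) * p.2) (- (2%:R * c.1)) (- (2%:R * c.2))
  (c.1 ^+ 2 + c.2 ^+ 2 - ((c.1 - r.1) ^+ 2 + (c.2 - r.2) ^+ 2))) => //.
1-6: by subfield.
- by rewrite -zc; ring.
Qed.

(** Subtracting the two equations gives the radical axis, a line with normal [c' - c], which reduces
    to a line and a circle. Concentric circles with a common point coincide, so the centres
    differ. *)
Lemma circle_circle_mem (R : realType) (K : divringClosed R)
    (c r c' r' z : R * R) :
  (forall t, t ^+ 2 \in K -> t \in K) ->
  c.1 \in K -> c.2 \in K -> r.1 \in K -> r.2 \in K ->
  c'.1 \in K -> c'.2 \in K -> r'.1 \in K -> r'.2 \in K ->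
  circle c r <> circle c' r' -> circle c r z -> circle c' r' z ->
  z.1 \in K /\ z.2 \in K.
Proof.
move=> sqrtK c1 c2 r1 r2 c1' c2' r1' r2' neq /circleE zc /circleE zc'.
have [cc'|/eqP/pair_neq_sub cc'] := eqVneq c c'.
  exfalso; apply: neq; rewrite -cc' in zc' *.
  by apply/seteqP; split=> t /circleE tE; apply/circleE;
    rewrite tE -zc -zc'.
have := @line_circle_mem _ K (c'.1 - c.1) (c'.2 - c.2)
  (((c.1 - r.1) ^+ 2 + (c.2 - r.2) ^+ 2 - ((c'.1 - r'.1) ^+ 2 + (c'.2 - r'.2) ^+ 2)
   - (c.1 ^+ 2 + c.2 ^+ 2) + (c'.1 ^+ 2 + c'.2 ^+ 2)) / 2%:R)
  (- (2%:R * c.1)) (- (2%:R * c.2))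
  (c.1 ^+ 2 + c.2 ^+ 2 - ((c.1 - r.1) ^+ 2 + (c.2 - r.2) ^+ 2)) z.1 z.2.
apply=> //.
1-6: by subfield.
- by rewrite orbC -(opprB c.1) oppr_eq0.
- by rewrite -zc -zc'; field.
- by rewrite -zc; ring.
Qed.

(* Coordinates of constructible points *)
Scheme constructible_mind := Induction for constructible Sort Prop
with drawn_line_mind := Induction for drawn_line Sort Prop
with drawn_circle_mind := Induction for drawn_circle Sort Prop.

(** Mutual induction; the invariant for a drawn line or circle is that it is determined by two
    distinct points with coordinates in [K]. *)
Lemma constructible_mem (R : realType) (K : divringClosed R)
    (S : set (R * R)) :
  (forall t, t ^+ 2 \in K -> t \in K) ->
  (forall p, S p -> p.1 \in K /\ p.2 \in K) ->
  forall p, constructible S p -> p.1 \in K /\ p.2 \in K.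
Proof.
move=> sqrtK SK; pose inK (p : R * R) := p.1 \in K /\ p.2 \in K.
apply: (@constructible_mind R S (fun p _ => inK p)
  (fun l _ => exists p q, [/\ inK p, inK q, p <> q & l = line p q])
  (fun c _ => exists p q, [/\ inK p, inK q, p <> q & c = circle p q])).
- by move=> p /SK.
- move=> l1 l2 z _ [p [q [[? ?] [? ?] pq ->]]] _ [p' [q' [[? ?] [? ?] pq' ->]]].
  exact: line_line_mem.
- move=> l c z _ [p [q [[? ?] [? ?] pq ->]]] _ [p' [q' [[? ?] [? ?] pq' ->]]].
  exact: line_circle_points_mem.
- move=> c c' z _ [p [q [[? ?] [? ?] pq ->]]] _ [p' [q' [[? ?] [? ?] pq' ->]]].
  exact: circle_circle_mem.
- by move=> p q _ pK _ qK pq; exists p, q.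
- by move=> p q _ pK _ qK pq; exists p, q.
Qed.

(** * The complex number [e^(i a)] and its transcendence *)

Definition cis (R : realType) (a : R) : R[i] := (cos a +i* sin a)%C.

Lemma cisX (R : realType) (a : R) (n : nat) : cis a ^+ n = cis (a * n%:R).
Proof.
elim: n => [|n IHn]; first by rewrite expr0 mulr0 /cis cos0 sin0.
rewrite exprS IHn /cis -natr1 mulrDr mulr1 addrC cosD sinD.
by apply/eqP; rewrite eq_complex /= addrC [cos a * _ + _]addrC addrC !eqxx.
Qed.

Lemma cisE (R : realType) (a : R) :
  cis a = (cos a)%:C%C + 'i%C * (sin a)%:C%C.
Proof. exact: (complexE (cis a)). Qed.

Lemma cisV (R : realType) (a : R) :
  (cis a)^-1 = (cos a)%:C%C - 'i%C * (sin a)%:C%C.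
Proof.
have h : cis a * ((cos a)%:C%C - 'i%C * (sin a)%:C%C) = 1.
  rewrite cisE mulrC -subr_sqr exprMn sqr_i mulN1r opprK -!rmorphXn -rmorphD /=.
  by rewrite cos2Dsin2.
exact: mulr1_eq h.
Qed.

Lemma cis_transcendental (R : realType) (a : R) :
  transcendental (cos a) -> ~ algebraicOver (ratr : rat -> R[i]) (cis a).
Proof.
move=> ctr zalg; apply: ctr.
have two_alg : algebraicOver (ratr : rat -> R[i]) 2.
  by rewrite -(ratr_nat _ 2); exact: algebraic_id.
have := algebraic_div (algebraic_add zalg (algebraic_inv zalg)) two_alg.
have -> : (cis a + (cis a)^-1) / 2 = (cos a)%:C%C.
  by rewrite cisV cisE; field.
(* A rational polynomial vanishing at [cos a] in [R[i]] already vanishes there in [R], as the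
   embedding is injective. *)
case=> p p0 pc; exists p => //; move: pc.
rewrite -(fmorph_root (real_complex R)) -map_poly_comp.
by congr (root _ _); apply: eq_map_poly => x /=; rewrite fmorph_rat.
Qed.

(** * Transcendental cosines exclude sectability *)

Lemma not_power_of_two_odd_part (n : nat) :
  (0 < n)%N -> ~ power_of_two n ->
  exists k m, [/\ odd m, (1 < m)%N & n = (2 ^ k * m)%N].
Proof.
move=> n0 npow; exists (logn 2 n), (n`_2^')%N.
have nE : n = (2 ^ logn 2 n * n`_2^')%N by rewrite -p_part partnC.
split=> //; first by rewrite odd_2'nat part_pnat.
rewrite ltn_neqAle part_gt0 andbT; apply/eqP => n1.
by apply: npow; exists (logn 2 n); rewrite {1}nE -n1 muln1.
Qed.

Lemma transcendental_not_sectable (R : realType) (alpha : R) (n : nat) :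
  transcendental (cos alpha) -> (0 < n)%N -> ~ power_of_two n ->
  ~ sectable n alpha.
Proof.
move=> ctr n0 npow sect.
have [k [m [m_odd m_gt1 nE]]] := not_power_of_two_odd_part n0 npow.
have [K0 [zK0 noroot0]] :=
  simple_transcendental_extension m_gt1 (cis_transcendental ctr).
have [K [zK noroot sqrtK]] := sqrt_closed_extension m_odd zK0 noroot0.
(* Constructibility concerns real coordinates, so [K] is cut down to its real elements, which
   inherit closure under square roots. *)
pose P : {pred R} := [pred x | x%:C%C \in K].
have Pclosed : GRing.divring_closed P.
  split=> [|x y|x y]; rewrite !inE.
  - exact: rpred1.
  - by rewrite rmorphB; exact: rpredB.
  - by rewrite fmorph_div; exact: rpred_div.
pose HP := GRing.isDivringClosed.Build R P Pclosed.
pose KR : divringClosed R := HB.pack P HP.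
have KRE x : (x \in KR) = (x%:C%C \in K) by [].
have sqrtKR t : t ^+ 2 \in KR -> t \in KR.
  by rewrite !KRE rmorphXn; exact: sqrtK.
have iK : 'i%C \in K by apply: sqrtK; rewrite sqr_i rpredN rpred1.
have cK : cos alpha \in KR.
  rewrite KRE.
  have -> : (cos alpha)%:C%C = (cis alpha + (cis alpha)^-1) / 2.
    by rewrite cisV cisE; field.
  by subfield.
have sK : sin alpha \in KR.
  by apply: sqrtKR; rewrite sin2cos2; subfield.
have [] := constructible_mem sqrtKR _ sect.
  by move=> _ [[->|->]|->]; split; subfield.
rewrite /= !KRE => cwK swK.
have wK : cis (alpha / n%:R) \in K by rewrite cisE; subfield.
(* With [n = 2^k m], the [2^k]-th power of [e^(i alpha / n)] is a forbidden [m]-th root of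
   [e^(i alpha)]. *)
have := noroot (cis (alpha / n%:R) ^+ (2 ^ k)) (rpredX _ wK).
by rewrite -exprM -nE cisX divfK ?eqxx// pnatr_eq0 -lt0n.
Qed.

(** * Countability of the sectable angles and uncountability of the circle *)

Lemma finite_roots (R : idomainType) (p : {poly R}) :
  p != 0 -> finite_set [set x | root p x].
Proof.
move=> p0; apply: contrapT => /(infinite_set_fset (size p))[B Broot].
apply/negP; rewrite -ltnNge; apply: max_poly_roots => //; last exact: finmap.fset_uniq.
by apply/allP => x xB; exact: Broot.
Qed.

Lemma countable_algebraic (R : realType) :
  countable [set x : R | ~ transcendental x].
Proof.
apply: (@sub_countable _ _ _ (\bigcup_(p in [set p : {poly rat} | p != 0])
  [set x | root (map_poly ratr p) x])).
  apply: subset_card_le => x /contrapT[p p0 px]; exists p => //.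
apply: bigcup_countable => [|p p0]; first exact: countableP.
apply: finite_set_countable; apply: finite_roots.
by rewrite map_poly_eq0.
Qed.

(** Sectable angles have algebraic cosine, and a point of the circle is determined by its cosine and
    the sign of its sine, recorded by the boolean [e] of [f]. *)
Lemma countable_sectable (R : realType) (n : nat) :
  (0 < n)%N -> ~ power_of_two n ->
  countable [set angle_point a | a in [set a : R | sectable n a]].
Proof.
move=> n0 npow.
pose A := [set x : R | ~ transcendental x].
pose f (x : R) (e : bool) := (x, (-1) ^+ e * Num.sqrt (1 - x ^+ 2)).
apply: (@sub_countable _ _ _ (\bigcup_(x in A) range (f x))).
  apply: subset_card_le => _ [a sa <-]; exists (cos a).
    by move=> /transcendental_not_sectable /(_ n0 npow).
  exists (sin a < 0) => //; rewrite /f /angle_point -sin2cos2 sqrtr_sqr.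
  have [h|h] := ltP (sin a) 0; first by rewrite ltr0_norm// expr1 mulN1r opprK.
  by rewrite ger0_norm// expr0 mul1r.
apply: bigcup_countable => [|x _]; first exact: countable_algebraic.
by apply: sub_countable (card_image_le _ _) _; exact: countableP.
Qed.

(** The first coordinate maps the circle onto a set containing [[0, 1]], which has Lebesgue measure
    [1], whereas countable sets are null. *)
Lemma uncountable_circle (R : realType) : ~ countable (range (@angle_point R)).
Proof.
move=> cnt; have : countable `[(0 : R), 1]%classic.
  apply: sub_countable (cnt); apply: card_le_trans (card_image_le fst _).
  apply: subset_card_le => x; rewrite /= in_itv /= => /andP[x0 x1].
  exists (angle_point (acos x)); first by exists (acos x).
  by rewrite /= acosK// in_itv/= x1 (le_trans _ x0)// lerN10.
move=> /countable_lebesgue_measure0 /eqP.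
by rewrite lebesgue_measure_itv/= lte_fin ltr01 oppr0 adde0 eqe oner_eq0.
Qed.

Theorem theoremA2 (R : realType) :
  (forall (alpha : R) (n : nat),
     transcendental (cos alpha) -> (0 < n)%N -> ~ power_of_two n ->
     ~ sectable n alpha) /\
  (forall n : nat, (0 < n)%N -> ~ power_of_two n ->
     ~ countable [set angle_point alpha | alpha in [set a : R | ~ sectable n a]] /\
     countable [set angle_point alpha | alpha in [set a : R | sectable n a]]).
Proof.
split=> [alpha n|n n0 npow]; first exact: transcendental_not_sectable.
split=> [cnt|]; last exact: countable_sectable.
(* The circle is the union of the two sets of points, so both being countable would make it
   countable. *)
apply: (@uncountable_circle R).
apply: (@sub_countable _ _ _
  ([set angle_point a | a in [set a : R | ~ sectable n a]] `|`
   [set angle_point a | a in [set a : R | sectable n a]])).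
  apply: subset_card_le => _ [a _ <-].
  by have [sa|sa] := pselect (sectable n a); [right|left]; exists a.
rewrite -bigcup2E; apply: bigcup_countable => // -[|[|i]] _ //=.
exact: countable_sectable.
Qed.
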